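(* Let $K>0$, $\alpha\in\mathbb{R}$, and let $\Omega$ be the mean value of $g(\omega)$, where $g$ is a probability density function on $\mathbb{R}$ that is even and unimodal about $\Omega$. Suppose that $u(t)$ is bounded and continuous on $\mathbb{R}$. (i) For a steady state solution $\rho_*$ of the infinite-dimensional Kuramoto system with input (given in the context) with $\Omega=\alpha=0$, its order parameters $r_n=:c_n$ are real numbers for any $n\in\mathbb{Z}$. (ii) For the infinite-dimensional Kuramoto system with input (with the given $\Omega$, $\alpha$ and $u$), there exists a solution $\rho$ constructed from $\rho_*$ such that the $n$-th order parameters of $\rho$ are expressed as $$r_n(\alpha u;t)=c_n\,e^{in\left(\Omega t+\alpha\int_0^t u(s)\,ds\right)},\qquad t>0,\ c_n\in\mathbb{R}.$$
   Context: Even and unimodal about $\Omega$ means: $g(\Omega+\omega)=g(\Omega-\omega)$ for any $\omega\in\mathbb{R}$; $g(\omega_1)>g(\omega_2)$ for $\Omega\le\omega_1<\omega_2$; and $g(\omega_1)<g(\omega_2)$ for $\omega_1<\omega_2\le\Omega$. The infinite-dimensional Kuramoto system with input $u=u(t)$, constant $\alpha$, coupling strength $K$ and natural frequency density $g$ is $$\frac{\partial\rho}{\partial t}+\frac{\partial}{\partial\theta}(\rho v)=0,\qquad v=\alpha u+\omega+K|r|\sin(\psi-\theta),$$ $$r(\alpha u;t)=|r(\alpha u;t)|e^{i\psi(\alpha u;t)}:=\int_{\mathbb{R}}\int_0^{2\pi}e^{i\theta}\rho(\alpha u;\theta,\omega,t)\,g(\omega)\,d\theta\,d\omega,$$ where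 $\rho=\rho(\alpha u;\theta,\omega,t)$ is the density of oscillators at phase $\theta$ (on the circle), parameterized by natural frequency $\omega\in\mathbb{R}$ and time $t$, $v=v(\alpha u;\theta,\omega,t)$ is the drift velocity of the oscillators, and $r(\alpha u;t)$ is the complex order parameter of $\rho$, with argument $\psi$. The $n$-th order parameter of a solution $\rho$ is $$r_n(\alpha u;t):=\int_{\mathbb{R}}\int_0^{2\pi}e^{in\theta}\rho(\alpha u;\theta,\omega,t)\,g(\omega)\,d\theta\,d\omega,\qquad n\in\mathbb{Z}.$$ The system ''with $\Omega=\alpha=0$'' is the system above with $\alpha=0$ and with $g$ replaced by its translate $\tilde g(\omega):=g(\omega+\Omega)$, which has mean value $0$; the order parameters in (i) are computed with $\tilde g$ in place of $g$. A steady state solution is a time-independent solution.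
   Formalization: In (i), realness is claimed for steady states that are density functions in θ, or measure-valued ones with ψ=0 (r=|r|) and no mass at cos θ<0 for |ω|<K|r|; without this it fails, e.g. rotating a partially locked state by π/2 makes r_1 imaginary. *)

(* Defs.v *)
From HB Require Import structures.
From mathcomp Require Import all_boot all_order all_algebra.
From mathcomp Require Import complex.
From mathcomp Require Import all_classical all_reals all_analysis.
Set Implicit Arguments.
Unset Strict Implicit.
Unset Printing Implicit Defensive.
Import Order.TTheory GRing.Theory Num.Theory.
Import numFieldNormedType.Exports.
Import ComplexField.Normc.
Local Open Scope classical_set_scope.
Local Open Scope ring_scope.

Definition is_density (R : realType) (g : R -> R) : Prop :=
  [/\ measurable_fun setT g, (forall w, 0 <= g w) &
      (\int[lebesgue_measure]_w (g w)%:E = 1)%E].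

(* [+oo - oo] is [-oo] in [\bar R], so a finite value of this integral forces
   [w * g w] to be integrable: the mean value exists and equals [m]. *)
Definition has_mean (R : realType) (g : R -> R) (m : R) : Prop :=
  (\int[lebesgue_measure]_w (w * g w)%:E = m%:E)%E.

Definition even_unimodal (R : realType) (g : R -> R) (m : R) : Prop :=
  [/\ (forall w, g (m + w) = g (m - w)),
      (forall w1 w2, m <= w1 -> w1 < w2 -> g w2 < g w1) &
      (forall w1 w2, w1 < w2 -> w2 <= m -> g w1 < g w2)].

(* The circle is represented by its fundamental domain [0, 2 pi). *)
Definition circle (R : realType) : set R := `[0, 2 * pi[.
Arguments circle : clear implicits.

Definition mod2pi (R : realType) (x : R) : R :=
  x - 2 * pi * (Num.floor (x / (2 * pi)))%:~R.

Definition cis (R : realType) (x : R) : R[i] := Complex (cos x) (sin x).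

(* The state of the system at a fixed time: [nu w] is the distribution of the
   phases of the oscillators of natural frequency [w], that is
   rho(theta, w) dtheta.  Measures rather than functions of theta are needed
   because phase-locked oscillators form Dirac masses. *)
Notation phase_kernel R :=
  (R.-pker (measurableTypeR R) ~> (measurableTypeR R)).

Definition on_circle (R : realType) (nu : phase_kernel R) : Prop :=
  forall w, nu w (circle R) = 1%E.

(* The integral of e^{i n theta} g(w) over nu(w)(dtheta) dw, taken separately
   on real and imaginary parts. *)
Definition order_parameter (R : realType) (g : R -> R) (nu : phase_kernel R)
    (n : int) : R[i] :=
  Complex
    (\int[lebesgue_measure]_w
       ((\int[nu w]_(x in circle R) cos (n%:~R * x)) * g w))
    (\int[lebesgue_measure]_w
       ((\int[nu w]_(x in circle R) sin (n%:~R * x)) * g w)).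

Definition test_function (R : realType) (phi : R -> R) : Prop :=
  [/\ (forall x, derivable phi x 1), continuous (derive1 phi) &
      periodic phi (2 * pi)].

Definition velocity (R : realType) (K a : R) (r : R[i]) (psi w x : R) : R :=
  a + w + K * normc r * sin (psi - x).

(* Measure-valued solutions for t > 0, the continuity equation being tested
   against C^1 functions on the circle:
     d/dt \int phi drho = \int phi' v drho.
   [psi] is any argument of r; [v] does not depend on its choice. *)
Definition kuramoto_solution (R : realType) (K alpha : R) (u g : R -> R)
    (rho : R -> phase_kernel R) : Prop :=
  let r t := order_parameter g (rho t) 1 in
  (forall t, 0 < t -> on_circle (rho t)) /\
  exists2 psi : R -> R,
    (forall t, 0 < t -> r t = `|r t| * cis (psi t)) &
    forall (w t : R) (phi : R -> R), 0 < t -> test_function phi ->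
      is_derive t 1 (fun s => \int[rho s w]_(x in circle R) phi x)
        (\int[rho t w]_(x in circle R)
           (derive1 phi x * velocity K (alpha * u t) (r t) (psi t) w x)).

Definition steady_state (R : realType) (K alpha : R) (u g : R -> R)
    (nu : phase_kernel R) : Prop :=
  kuramoto_solution K alpha u g (fun=> nu).

Definition has_phase_density (R : realType) (nu : phase_kernel R) : Prop :=
  exists f : R -> R -> R, forall w,
    [/\ measurable_fun setT (f w), (forall x, 0 <= f w x) &
        forall A, measurable A ->
          nu w A = (\int[lebesgue_measure]_(x in A) (f w x)%:E)%E].

(* The usual normalization of a partially locked state: the origin of the phase
   is such that psi = 0, i.e. r = |r|, and no locked oscillator (|w| < K |r|)
   sits at the repelling zero of v = w - K |r| sin theta, where
   dv/dtheta = - K |r| cos theta > 0.  A steady state with Dirac masses that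
   violates one of these conditions may have non-real order parameters: a
   rotation multiplies r_n by e^{i n a}, and a fraction of repelling phases that
   is not even in w makes the integral of sin(2 theta) nonzero. *)
Definition standard_form (R : realType) (K : R) (g : R -> R)
    (nu : phase_kernel R) : Prop :=
  let r := order_parameter g nu 1 in
  r = `|r| /\
  forall w, `|w| < K * normc r -> nu w [set x | cos x < 0] = 0%E.

Definition phase_shift (R : realType) (Omega alpha : R) (u : R -> R) (t : R) :
    R :=
  Omega * t + alpha * \int[lebesgue_measure]_(s in `[0, t]) u s.

(* Main.v *)
(* In the frame rotating with the phase shift s(t) = Omega t + alpha \int_0^t u,
   the drift Omega + alpha u disappears.  Hence pushing rho_star(w - Omega)
   forward by the rotation of angle s(t) turns a steady state of the centred
   system into a solution of the full one, and multiplies the n-th order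
   parameter by e^{i n s(t)}.

   For (i), both hypotheses reduce the velocity to w - a sin x with a = K |r|:
   unless a = 0, the phases at w = 0 concentrate on the zeros of sin (psi - x),
   so a steady state with a density is incoherent.  The imaginary part of c_n
   then vanishes because the n-th sine moment is odd in w for |w| <> a.  For
   |w| > a, testing against cos (n x) and sin (n x) gives a linear recurrence that
   determines the trigonometric moments among bounded sequences and is invariant
   under (w, x) -> (-w, -x).  For |w| < a, the phases sit at the point with
   sin x = w / a and cos x >= 0. *)
Require Import Defs.
From HB Require Import structures.
From mathcomp Require Import all_boot all_order all_algebra.
From mathcomp Require Import complex.
From mathcomp Require Import all_classical all_reals all_analysis.
From mathcomp Require Import measurable_realfun ring lra.
Import Order.TTheory GRing.Theory Num.Theory.
Import numFieldNormedType.Exports.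
Local Open Scope classical_set_scope.
Local Open Scope ring_scope.
Set Implicit Arguments.
Unset Strict Implicit.
Unset Printing Implicit Defensive.

(** * Invariance of Lebesgue measure *)

(** For nonnegative functions this is the change of variables for the pushforward of [mu] under
    [phi], which is [mu] itself. The general case treats positive and negative parts separately, so
    it covers functions whose integral is not finite. *)
Lemma integral_measure_preserving d (T : measurableType d) (R : realType)
    (mu : {measure set T -> \bar R}) (phi : T -> T) (f : T -> \bar R) :
  measurable_fun setT phi ->
  (forall A, measurable A -> mu (phi @^-1` A) = mu A) ->
  measurable_fun setT f ->
  (\int[mu]_x f x = \int[mu]_x f (phi x))%E.
Proof.
move=> mphi pres mf.
have ge0 (h : T -> \bar R) : measurable_fun setT h -> (forall x, 0 <= h x)%E ->
    (\int[mu]_x h x = \int[mu]_x h (phi x))%E.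
  move=> mh h0; transitivity (\int[pushforward mu phi]_x h x)%E.
    by apply: eq_measure_integral => A mA _; rewrite /= /pushforward pres.
  by rewrite ge0_integral_pushforward.
rewrite integralE [in RHS]integralE.
congr (_ - _)%E.
- rewrite (ge0 _ (measurable_funepos mf) (funepos_ge0 _)).
  by apply: eq_integral => x _; rewrite !funeposE.
- rewrite (ge0 _ (measurable_funeneg mf) (funeneg_ge0 _)).
  by apply: eq_integral => x _; rewrite !funenegE.
Qed.

(** The pushforward under translation gives half-open intervals their length, and this characterizes
    Lebesgue measure. *)
Lemma lebesgue_measure_shift (R : realType) (c : R) (A : set R) :
  measurable A ->
  lebesgue_measure ((fun x => x + c) @^-1` A) = lebesgue_measure A.
Proof.
move=> mA.
have mf : measurable_fun setT ((fun x : R => x + c) : _ -> measurableTypeR R).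
  exact: measurable_funD.
transitivity (pushforward lebesgue_measure
  ((fun x : R => x + c) : measurableTypeR R -> measurableTypeR R) A) => //.
apply/esym/lebesgue_measure_unique => //= _ [[a b]] _ <-.
rewrite /pushforward.
have -> : (fun x : R => x + c) @^-1` `]a, b]%classic = `]a - c, b - c]%classic.
  by apply/seteqP; split => x; rewrite /= !in_itv/= ltrBlDr lerBrDr.
rewrite !lebesgue_measure_itv/= !lte_fin ltrD2r -!EFinD.
by congr (if _ then (_)%:E else _); ring.
Qed.

Lemma Rintegral_lebesgue_shift (R : realType) (c : R) (f : R -> R) :
  measurable_fun setT f ->
  \int[lebesgue_measure]_x f x = \int[lebesgue_measure]_x f (x + c).
Proof.
move=> mf; congr fine.
apply: (@integral_measure_preserving _ (measurableTypeR R) R lebesgue_measure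
  (fun x => x + c) (EFin \o f)).
- exact: measurable_funD.
- by move=> A mA; exact: lebesgue_measure_shift.
- exact/measurable_EFinP.
Qed.

Lemma Rintegral_lebesgue_opp (R : realType) (f : R -> R) :
  measurable_fun setT f ->
  \int[lebesgue_measure]_x f x = \int[lebesgue_measure]_x f (- x).
Proof.
move=> mf; congr fine.
apply: (@integral_measure_preserving _ (measurableTypeR R) R lebesgue_measure
  -%R (EFin \o f)).
- exact: measurable_funN.
- by move=> A mA; rewrite -[RHS]lebesgue_measureN.
- exact/measurable_EFinP.
Qed.

(** The substitution x -> -x turns the integral into its opposite. The null set [N] leaves room for
    the frequencies with |w| = K |r|, where oddness of the sine moments is not established. *)
Lemma Rintegral_ae_odd (R : realType) (N : set R) (f : R -> R) :
  lebesgue_measure.-integrable setT (EFin \o f) ->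
  measurable N -> lebesgue_measure N = 0%E ->
  (forall x, ~ N x -> f (- x) = - f x) ->
  \int[lebesgue_measure]_x f x = 0.
Proof.
move=> intf mN N0 fodd.
have mf : measurable_fun setT f.
  by apply/measurable_EFinP; exact: (measurable_int lebesgue_measure).
have mNf : measurable_fun setT (fun x : R => f (- x)).
  by apply: (measurableT_comp mf); exact: measurable_funN.
suff E : \int[lebesgue_measure]_x f x = - \int[lebesgue_measure]_x f x.
  by move: E; set I := Rintegral _ _ _ => E; lra.
rewrite {1}Rintegral_lebesgue_opp// -mulN1r -RintegralZl//.
congr fine; apply: ae_eq_integral => //.
- exact/measurable_EFinP.
- by apply/measurable_EFinP; exact: measurable_funM.
- exists N; split=> // x /= /not_implyP[_ fx].
  by apply: contrapT => Nx; apply: fx; rewrite fodd// mulN1r.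
Qed.

(** Extension by zero outside [D], then splitting into positive and negative parts, reduces this to
    nonnegative integrands on the whole space. *)
Lemma measurable_kernel_Rintegral d d' (X : measurableType d)
    (Y : measurableType d') (R : realType) (k : R.-ker X ~> Y) (D : set Y)
    (h : Y -> R) :
  measurable D -> measurable_fun setT h ->
  measurable_fun setT (fun x => \int[k x]_(y in D) h y).
Proof.
move=> mD mh.
apply: (@measurableT_comp _ _ _ _ _ _ (fine : \bar R -> R)) => //.
pose h' := (EFin \o h) \_ D.
have mh' : measurable_fun setT h'.
  apply/(measurable_restrictT _ mD)/measurable_funTS/measurable_EFinP => //.
have -> : (fun x => (\int[k x]_(y in D) (h y)%:E)%E) =
  (fun x => (\int[k x]_y h'^\+ y)%E - (\int[k x]_y h'^\- y)%E)%E.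
  by apply/funext => x; rewrite integral_mkcond integralE.
apply: emeasurable_funB.
- apply: (measurable_fun_integral_kernel (measurable_kernel k)) => //.
  exact: measurable_funepos.
- apply: (measurable_fun_integral_kernel (measurable_kernel k)) => //.
  exact: measurable_funeneg.
Qed.

(** * Rotations of the circle *)

Lemma circle_mod2pi (R : realType) (x : R) : circle R (mod2pi x).
Proof.
have pi20 : 0 < 2 * pi :> R by rewrite mulr_gt0// pi_gt0.
have /andP[lo hi] := floor_itv (x / (2 * pi)).
rewrite /circle /mod2pi /= in_itv/=; apply/andP; split.
- rewrite subr_ge0 mulrC -ler_pdivlMr//.
- rewrite ltrBlDl -[X in _ + X]mulr1 -mulrDr mulrC -ltr_pdivrMr//.
  by rewrite intrD in hi.
Qed.

Lemma periodic_int (R : realType) (f : R -> R) (T : R) (k : int) (x : R) :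
  periodic f T -> f (x + T * k%:~R) = f x.
Proof.
move=> fT; case: k => n; first by rewrite -(periodicn fT n x) mulr_natr.
by rewrite -(periodicn fT n.+1) NegzE mulrNz mulrN mulr_natr subrK.
Qed.

Lemma periodic_mod2pi (R : realType) (f : R -> R) (x : R) :
  periodic f (2 * pi) -> f (mod2pi x) = f x.
Proof.
by move=> fT; rewrite /mod2pi -mulrN -mulrNz periodic_int.
Qed.

Lemma measurable_mod2pi (R : realType) : measurable_fun setT (@mod2pi R).
Proof.
have pi20 : 0 < 2 * pi :> R by rewrite mulr_gt0// pi_gt0.
apply: measurable_funB => //; apply: measurable_funM => //.
apply: nondecreasing_measurable => // x y xy /=.
by rewrite ler_int le_floor// ler_pM2r// invr_gt0.
Qed.

(** The norm attains a maximum on the compact interval [0, 2 pi], and [mod2pi] brings every point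
    there. *)
Lemma periodic_bounded (R : realType) (f : R -> R) :
  continuous f -> periodic f (2 * pi) ->
  exists M : R, forall x, `|f x| <= M.
Proof.
move=> cf fT.
have pi20 : 0 <= 2 * pi :> R by rewrite mulr_ge0// pi_ge0.
have cnf : continuous (fun x => `|f x|).
  by move=> x; apply: cvg_norm; exact: cf.
have [c _ maxc] := EVT_max pi20 (continuous_subspaceT cnf).
exists `|f c| => x; rewrite -(periodic_mod2pi _ fT) maxc//.
by have := circle_mod2pi x; rewrite /circle/= !in_itv/= => /andP[-> /ltW].
Qed.

(** * Bounded functions under a probability measure *)

Lemma bounded_integrable d (T : measurableType d) (R : realType)
    (mu : {measure set T -> \bar R}) (f : T -> R) (M : R) :
  mu setT = 1%E -> measurable_fun setT f -> (forall x, `|f x| <= M) ->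
  mu.-integrable setT (EFin \o f).
Proof.
move=> mu1 mf fM; apply: measurable_bounded_integrable => //.
  by rewrite mu1 ltry.
exists M; split; first exact: num_real.
by move=> N MN x _ /=; rewrite (le_trans (fM x))// ltW.
Qed.

Lemma le_norm_Rintegral_bounded d (T : measurableType d) (R : realType)
    (mu : {measure set T -> \bar R}) (f : T -> R) (M : R) :
  mu setT = 1%E -> measurable_fun setT f -> (forall x, `|f x| <= M) ->
  `|\int[mu]_x f x| <= M.
Proof.
move=> mu1 mf fM.
have intf := bounded_integrable mu1 mf fM.
have intn : mu.-integrable setT (EFin \o (fun x => `|f x|)).
  apply: (@bounded_integrable _ _ _ mu _ M) => //.
    exact: measurableT_comp.
  by move=> x; rewrite normr_id.
have intM : mu.-integrable setT (EFin \o cst M).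
  apply: (@bounded_integrable _ _ _ mu _ `|M|) => //.
have -> : M = \int[mu]_x cst M x by rewrite Rintegral_cst// mu1 mulr1.
apply: le_trans (le_normr_Rintegral _ intf) _ => //.
by apply: le_Rintegral => //.
Qed.

(** The circle carries the full mass, so its complement is null. Dropping the restriction lets
    integrands be shifted without moving the domain. *)
Lemma Rintegral_circle (R : realType)
    (mu : {measure set (measurableTypeR R) -> \bar R}) (f : R -> R) (M : R) :
  mu setT = 1%E -> mu (circle R) = 1%E ->
  measurable_fun setT f -> (forall x, `|f x| <= M) ->
  \int[mu]_(x in circle R) f x = \int[mu]_x f x.
Proof.
move=> mu1 muc mf fM.
have mc : measurable (circle R) by exact: measurable_itv.
have muC : mu (~` circle R) = 0%E.
  rewrite -setTD measureD//= ?setTI; last by rewrite [ltLHS]mu1 ltry.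
  by rewrite [X in (X - _)%E]mu1 [X in (_ - X)%E]muc subee.
rewrite /Rintegral [in RHS](@negligible_integral _ _ _ mu setT (~` circle R))//.
- by rewrite setTD setCK.
- exact: measurableC.
- exact: bounded_integrable mu1 mf fM.
Qed.

(** * Test functions and their translates *)

Lemma test_function_derive (R : realType) (phi dphi : R -> R) :
  (forall x : R, is_derive x 1 phi (dphi x)) -> continuous dphi ->
  periodic phi (2 * pi) -> test_function phi /\ derive1 phi = dphi.
Proof.
move=> dphiE cdphi pphi.
have E : derive1 phi = dphi.
  by apply/funext => x; rewrite derive1E; have [_ ->] := dphiE x.
by split => //; split => //; rewrite E.
Qed.

Lemma derive1_shift (R : realType) (phi : R -> R) (c x : R) :
  derivable phi (x + c) 1 ->
  is_derive x 1 (fun y => phi (y + c)) (derive1 phi (x + c)).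
Proof.
move=> dphi.
have d1 : is_derive (x + c) 1 phi (derive1 phi (x + c)).
  by rewrite derive1E; exact: derivableP.
have -> : (fun y => phi (y + c)) = phi \o (fun y => y + c) by [].
by apply: is_derive_eq; rewrite addr0 mulr1.
Qed.

Lemma test_function_shift (R : realType) (phi : R -> R) (c : R) :
  test_function phi ->
  test_function (fun x => phi (x + c)) /\
  derive1 (fun x => phi (x + c)) = (fun x => derive1 phi (x + c)).
Proof.
move=> [dphi cdphi pphi]; apply: test_function_derive => [x|x|x].
- exact: derive1_shift.
- apply: continuous_comp; last exact: cdphi.
  by apply: cvgD; [exact: cvg_id|exact: cvg_cst].
- by rewrite addrAC pphi.
Qed.

(** Differentiation commutes with translation, and translation by 2 pi fixes [phi]. *)
Lemma periodic_derive1 (R : realType) (phi : R -> R) :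
  test_function phi -> periodic (derive1 phi) (2 * pi).
Proof.
move=> tphi x.
have [_ /(congr1 (@^~ x)) /= <-] := test_function_shift (2 * pi) tphi.
by congr (derive1 _ x); apply/funext => y; have [_ _ ->] := tphi.
Qed.

Lemma continuous_test_function (R : realType) (phi : R -> R) :
  test_function phi -> continuous phi.
Proof.
by move=> [dphi _ _] x; apply/differentiable_continuous/derivable1_diffP.
Qed.

(** * Rotated kernels and derivatives along a rotation *)

Definition turn (R : realType) (c x : R) : R := mod2pi (x + c).

Lemma measurable_turn (R : realType) (c : R) :
  measurable_fun setT (@turn R c).
Proof.
by apply: measurableT_comp; [exact: measurable_mod2pi|exact: measurable_funD].
Qed.

Section turned_kernel.
Context (R : realType) (nu : phase_kernel R) (Omega c : R).

Let turnR : measurableTypeR R -> measurableTypeR R := turn c.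

Let mturn : measurable_fun setT turnR.
Proof. exact: measurable_turn. Qed.

(* The name of the canonical instance is explicit because measurability of the
   rotation, an argument of this instance, is not found by unification. *)
Definition turned_kernel (w : measurableTypeR R) :
    {measure set (measurableTypeR R) -> \bar R} :=
  measure_function_pushforward__canonical__measure_function_Measure
    (nu (w - Omega)) mturn.

Let measurable_turned_kernel U : measurable U ->
  measurable_fun setT (turned_kernel ^~ U).
Proof.
move=> mU.
have mtU : measurable (turnR @^-1` U).
  by rewrite -[X in measurable X]setTI; exact: mturn.
apply: (@measurableT_comp _ _ _ _ _ _ (nu ^~ (turnR @^-1` U))).
  exact: measurable_kernel.
exact: measurable_funB.
Qed.

HB.instance Definition _ :=
  isKernel.Build _ _ _ _ R turned_kernel measurable_turned_kernel.

Let turned_kernel_prob w : turned_kernel w setT = 1%E.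
Proof. by rewrite /turned_kernel /= /pushforward preimage_setT prob_kernel. Qed.

HB.instance Definition _ :=
  Kernel_isProbability.Build _ _ _ _ R turned_kernel turned_kernel_prob.

End turned_kernel.

Lemma normr_cis (R : realType) (x : R) : `|cis x| = 1.
Proof. by rewrite normc_def /= cos2Dsin2 sqrtr1. Qed.

Lemma normc_ge0 (R : realType) (z : R[i]) : 0 <= ComplexField.Normc.normc z.
Proof. by case: z => x y; exact: sqrtr_ge0. Qed.

Lemma cisD (R : realType) (x y : R) : cis (x + y) = cis x * cis y.
Proof. by rewrite /cis cosD sinD; congr Complex; ring. Qed.

Lemma is_derive_phase_shift (R : realType) (Omega alpha : R) (u : R -> R)
    (t : R) :
  continuous u -> 0 < t ->
  is_derive t 1 (phase_shift Omega alpha u) (Omega + alpha * u t).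
Proof.
move=> cu t0.
(* The bound t + 1 makes t an interior point of the interval to which the fundamental theorem of
   calculus is applied. *)
have tt1 : t < t + 1 by rewrite ltrDl.
have intu : lebesgue_measure.-integrable `[0, t + 1] (EFin \o u).
  apply: continuous_compact_integrable; first exact: segment_compact.
  exact: continuous_subspaceT.
have [du uE] := continuous_FTC1_closed tt1 intu t0 (cu t).
have dI : is_derive t 1
    (fun t => \int[lebesgue_measure]_(s in `[0, t]) u s) (u t).
  by rewrite -uE derive1E; exact: derivableP.
apply: is_derive_eq.
by rewrite /GRing.scale/= mulr1.
Qed.

(** Differentiation under the integral sign: the derivative of [phi] is continuous and periodic, so
    a constant dominates it, and constants are integrable for a probability measure. *)
Lemma is_derive_Rintegral_shift (R : realType)
    (mu : {measure set (measurableTypeR R) -> \bar R}) (phi : R -> R) (y : R) :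
  mu setT = 1%E -> test_function phi ->
  is_derive y 1 (fun y => \int[mu]_x phi (x + y))
                (\int[mu]_x derive1 phi (x + y)).
Proof.
move=> mu1 tphi; have [dphi cdphi pphi] := tphi.
have cphi := continuous_test_function tphi.
have [M phiM] := periodic_bounded cphi pphi.
have [M' dphiM'] := periodic_bounded cdphi (periodic_derive1 tphi).
pose f (y x : R) := phi (x + y).
have d1f (z x : R) : is_derive z 1 (f ^~ x) (derive1 phi (x + z)).
  have -> : f ^~ x = (fun z => phi (z + x)).
    by apply/funext => z'; rewrite /f addrC.
  by rewrite addrC; apply: derive1_shift.
have d1E (z x : R) : partial1of2 f z x = derive1 phi (x + z).
  by rewrite partial1of2E; have [_ ->] := d1f z x.
(* The radius 1 is arbitrary, since the dominating constant is uniform in the shift. *)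
have Iy : `]y - 1, y + 1[%classic y.
  by rewrite /= in_itv/= ltrBlDr ltrDl ltr01.
have mshift z : measurable_fun setT (f z).
  apply: continuous_measurable_fun => x.
  apply: continuous_comp; last exact: cphi.
  by apply: cvgD; [exact: cvg_id|exact: cvg_cst].
have intf (z : R) : `]y - 1, y + 1[%classic z ->
    mu.-integrable setT (EFin \o f z).
  move=> _; apply: (@bounded_integrable _ _ _ mu _ M).
  - exact: mu1.
  - exact: mshift.
  - by move=> x; exact: phiM.
have derf (z x : R) : `]y - 1, y + 1[%classic z -> [set: R] x ->
    derivable (f ^~ x) z 1.
  by move=> _ _; have [] := d1f z x.
have intM : mu.-integrable setT (EFin \o (fun _ => `|M'|)).
  by apply: (@bounded_integrable _ _ _ mu _ `|M'|) => // x; rewrite normr_id.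
have G_ub (z x : R) : `]y - 1, y + 1[%classic z -> [set: R] x ->
    `|partial1of2 f z x| <= `|M'|.
  by move=> _ _; rewrite d1E (le_trans (dphiM' _))// ler_norm.
have M'0 (x : measurableTypeR R) : 0 <= `|M'| by [].
apply: DeriveDef.
  exact: (derivable_under_integral measurableT Iy intf derf M'0 intM G_ub).
rewrite -derive1E.
rewrite (differentiation_under_integral measurableT Iy intf derf M'0 intM G_ub).
by apply: eq_Rintegral => x _; rewrite d1E.
Qed.

Section rotating_solution.
Context (R : realType) (nu : phase_kernel R).
Hypothesis nuc : on_circle nu.

(** Change of variables for a pushforward. Every rotated point lies in the fundamental domain, so
    the preimage of the circle is the whole line, and periodicity of [h] removes the reduction
    modulo 2 pi. *)
Lemma Rintegral_turned_kernel (Omega c w : R) (h : R -> R) :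
  continuous h -> periodic h (2 * pi) ->
  \int[turned_kernel nu Omega c w]_(x in circle R) h x =
  \int[nu (w - Omega)]_x h (x + c).
Proof.
move=> ch ph; have [M hM] := periodic_bounded ch ph.
have mh := continuous_measurable_fun ch.
transitivity (\int[nu (w - Omega)]_(x in turn c @^-1` circle R) h (turn c x)).
  congr fine.
  apply: (@integral_pushforward _ _ (measurableTypeR R) (measurableTypeR R) R
    (turn c) (measurable_turn c) (nu (w - Omega)) (circle R) (EFin \o h)).
  - exact/measurable_EFinP.
  - apply: (integrableS (E := setT)) => //.
      rewrite -[X in measurable X]setTI; apply: measurable_turn => //.
      exact: measurable_itv.
    apply: (@bounded_integrable _ _ _ (nu (w - Omega)) _ M) => //=.
      exact: prob_kernel.
    by apply: measurableT_comp => //; exact: measurable_turn.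
  - exact: measurable_itv.
have -> : turn c @^-1` circle R = setT.
  by apply/seteqP; split => // x _; exact: circle_mod2pi.
by apply: eq_Rintegral => x _; rewrite /turn periodic_mod2pi.
Qed.

Lemma on_circle_turned_kernel (Omega c : R) :
  on_circle (turned_kernel nu Omega c).
Proof.
move=> w; rewrite /turned_kernel /= /pushforward.
have -> : turn c @^-1` circle R = setT.
  by apply/seteqP; split => // x _; exact: circle_mod2pi.
exact: prob_kernel.
Qed.

Lemma Rintegral_circle_periodic (w : R) (h : R -> R) :
  continuous h -> periodic h (2 * pi) ->
  \int[nu w]_(x in circle R) h x = \int[nu w]_x h x.
Proof.
move=> ch ph; have [M hM] := periodic_bounded ch ph.
apply: (Rintegral_circle (M := M)) => //.
- exact: prob_kernel.
- exact: continuous_measurable_fun.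
Qed.

End rotating_solution.

(** * Rotating solutions *)

Lemma density_integrable (R : realType) (g : R -> R) :
  is_density g -> lebesgue_measure.-integrable setT (EFin \o g).
Proof.
move=> [mg g0 g1]; apply/integrableP; split; first exact/measurable_EFinP.
rewrite (_ : (fun x => _) = EFin \o g) ?g1 ?ltry//.
by apply/funext => x /=; rewrite ger0_norm.
Qed.

Lemma density_shift (R : realType) (g : R -> R) (c : R) :
  is_density g -> is_density (fun w => g (w + c)).
Proof.
move=> [mg g0 g1]; split => //.
  by apply: (measurableT_comp mg); exact: measurable_funD.
rewrite -g1; apply/esym.
apply: (@integral_measure_preserving _ (measurableTypeR R) R lebesgue_measure
  (fun x => x + c) (EFin \o g)).
- exact: measurable_funD.
- by move=> A mA; exact: lebesgue_measure_shift.
- exact/measurable_EFinP.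
Qed.

Section moments.
Context (R : realType) (nu : phase_kernel R).
Hypothesis nuc : on_circle nu.

Lemma measurable_moment (h : R -> R) : measurable_fun setT h ->
  measurable_fun setT (fun w => \int[nu w]_(x in circle R) h x).
Proof.
move=> mh; apply: measurable_kernel_Rintegral => //; exact: measurable_itv.
Qed.

Lemma moment_bounded (h : R -> R) (M w : R) : measurable_fun setT h ->
  (forall x, `|h x| <= M) -> `|\int[nu w]_(x in circle R) h x| <= M.
Proof.
move=> mh hM; have nu1 : nu w setT = 1%E by exact: prob_kernel.
by rewrite (Rintegral_circle nu1 (nuc w) mh hM) le_norm_Rintegral_bounded.
Qed.

(** The product is dominated by M g, and a density is integrable. *)
Lemma moment_integrable (g h : R -> R) (M : R) :
  is_density g -> measurable_fun setT h -> (forall x, `|h x| <= M) ->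
  lebesgue_measure.-integrable setT
    (EFin \o (fun w => (\int[nu w]_(x in circle R) h x) * g w)).
Proof.
move=> gd mh hM; have [mg g0 _] := gd.
have intMg :
    lebesgue_measure.-integrable setT (fun w => M%:E * (EFin \o g) w)%E.
  by apply: integrableZl => //; exact: density_integrable.
apply: le_integrable intMg => //.
  apply/measurable_EFinP; apply: measurable_funM => //.
  exact: measurable_moment.
move=> w _ /=; rewrite lee_fin !normrM ler_wpM2r//.
by rewrite (le_trans (moment_bounded w mh hM))// ler_norm.
Qed.

End moments.

Lemma continuous_cos_mul (R : realType) (n : R) :
  continuous (fun x : R => cos (n * x)).
Proof.
move=> x; apply: continuous_comp; last exact: continuous_cos.
by apply: cvgM; [exact: cvg_cst|exact: cvg_id].
Qed.

Lemma continuous_sin_mul (R : realType) (n : R) :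
  continuous (fun x : R => sin (n * x)).
Proof.
move=> x; apply: continuous_comp; last exact: continuous_sin.
by apply: cvgM; [exact: cvg_cst|exact: cvg_id].
Qed.

Lemma cos_int_periodic (R : realType) (n : int) :
  periodic (fun x : R => cos (n%:~R * x)) (2 * pi).
Proof.
move=> x; rewrite mulrDr (_ : n%:~R * (2 * pi) = (pi *+ 2) * n%:~R); last first.
  by rewrite mulr_natl mulrC.
by rewrite periodic_int//; exact: cosD2pi.
Qed.

Lemma sin_int_periodic (R : realType) (n : int) :
  periodic (fun x : R => sin (n%:~R * x)) (2 * pi).
Proof.
move=> x; rewrite mulrDr (_ : n%:~R * (2 * pi) = (pi *+ 2) * n%:~R); last first.
  by rewrite mulr_natl mulrC.
by rewrite periodic_int//; exact: sinD2pi.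
Qed.

(** The addition formulas express the rotated cosine and sine through the original pair, which is
    multiplication by e^{i n c}. Translating the frequency variable moves [Omega] from the kernel to
    [g]. *)
Lemma order_parameter_turned_kernel (R : realType) (nu : phase_kernel R)
    (g : R -> R) (Omega c : R) (n : int) :
  on_circle nu -> is_density g ->
  order_parameter g (turned_kernel nu Omega c) n =
  order_parameter (fun w => g (w + Omega)) nu n * cis (n%:~R * c).
Proof.
move=> nuc gd; have [mg _ _] := gd.
have g0d := density_shift Omega gd.
pose C x : R := cos (n%:~R * x); pose S x : R := sin (n%:~R * x).
have cC : continuous C by exact: continuous_cos_mul.
have cS : continuous S by exact: continuous_sin_mul.
have pC : periodic C (2 * pi) by exact: cos_int_periodic.
have pS : periodic S (2 * pi) by exact: sin_int_periodic.
have mC := continuous_measurable_fun cC.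
have mS := continuous_measurable_fun cS.
have C1 x : `|C x| <= 1 by exact: cos_max.
have S1 x : `|S x| <= 1 by exact: sin_max.
have intC w : (nu w).-integrable setT (EFin \o C).
  by apply: (@bounded_integrable _ _ _ (nu w) _ 1) => //; exact: prob_kernel.
have intS w : (nu w).-integrable setT (EFin \o S).
  by apply: (@bounded_integrable _ _ _ (nu w) _ 1) => //; exact: prob_kernel.
have iCg := moment_integrable nuc g0d mC C1.
have iSg := moment_integrable nuc g0d mS S1.
(* Common computation for the real and imaginary parts: [h] will be [C] or [S], with [a] and [b]
   read off the addition formulas. *)
have mo (h : R -> R) (a b : R) : continuous h -> periodic h (2 * pi) ->
    (forall x, h (x + c) = a * C x + b * S x) ->
    \int[lebesgue_measure]_w
      ((\int[turned_kernel nu Omega c w]_(x in circle R) h x) * g w) =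
    a * \int[lebesgue_measure]_w
      ((\int[nu w]_(x in circle R) C x) * g (w + Omega)) +
    b * \int[lebesgue_measure]_w
      ((\int[nu w]_(x in circle R) S x) * g (w + Omega)).
  move=> ch ph hE.
  have mh := continuous_measurable_fun ch.
  rewrite (Rintegral_lebesgue_shift Omega); last first.
    by apply: measurable_funM => //; exact: measurable_moment.
  transitivity (\int[lebesgue_measure]_w
     (a * ((\int[nu w]_(x in circle R) C x) * g (w + Omega)) +
      b * ((\int[nu w]_(x in circle R) S x) * g (w + Omega)))).
    apply: eq_Rintegral => w _.
    rewrite (Rintegral_turned_kernel _ _ _ _ ch ph) addrK !mulrA -mulrDl.
    congr (_ * _).
    rewrite (Rintegral_circle_periodic nuc _ cC pC).
    rewrite (Rintegral_circle_periodic nuc _ cS pS).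
    under eq_Rintegral do rewrite hE.
    rewrite RintegralD//; first by rewrite !RintegralZl.
    - exact: (@integrableZl _ _ _ _ _ _ a _ (intC w)).
    - exact: (@integrableZl _ _ _ _ _ _ b _ (intS w)).
  rewrite RintegralD//; first by rewrite !RintegralZl.
  - exact: (@integrableZl _ _ _ _ _ _ a _ iCg).
  - exact: (@integrableZl _ _ _ _ _ _ b _ iSg).
rewrite /order_parameter /cis.
rewrite (mo _ (C c) (- S c))//; last first.
  by move=> x; rewrite /C /S mulrDr cosD; ring.
rewrite (mo _ (S c) (C c))//; last first.
  by move=> x; rewrite /C /S mulrDr sinD; ring.
by congr Complex; rewrite -/(C c) -/(S c); ring.
Qed.

(** Weak form of the vanishing of d(rho v)/dtheta in the centred system. Here [r] and [psi] are free
    parameters; the link between [r] and [nu] is stated separately. *)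
Definition stationary (R : realType) (K : R) (r : R[i]) (psi : R)
    (nu : phase_kernel R) : Prop :=
  forall w phi, test_function phi ->
    \int[nu w]_(x in circle R) (derive1 phi x * velocity K 0 r psi w x) = 0.

Lemma steady_state_stationary (R : realType) (K : R) (u g : R -> R)
    (nu : phase_kernel R) : steady_state K 0 u g nu ->
  let r := order_parameter g nu 1 in
  on_circle nu /\ exists2 psi, r = `|r| * cis psi & stationary K r psi nu.
Proof.
(* Nothing depends on time, so the equation is read at t = 1. The integral being constant in time,
   its derivative is 0. *)
move=> [onc [psi rE der]] r; split; first exact: (onc 1 ltr01).
exists (psi 1); first exact: rE.
move=> w phi tphi.
have [_] := der w 1 phi ltr01 tphi.
rewrite mul0r => <-; exact: derive_cst.
Qed.

Lemma continuous_velocity (R : realType) (K a : R) (r : R[i]) (psi w : R) :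
  continuous (velocity K a r psi w).
Proof.
move=> x; apply: cvgD; first exact: cvg_cst.
apply: cvgM; first exact: cvg_cst.
apply: continuous_comp; last exact: continuous_sin.
by apply: cvgB; [exact: cvg_cst|exact: cvg_id].
Qed.

Lemma periodic_velocity (R : realType) (K a : R) (r : R[i]) (psi w : R) :
  periodic (velocity K a r psi w) (2 * pi).
Proof.
move=> x; rewrite /velocity; congr (_ + _ * _).
have -> : psi - x = psi - (x + 2 * pi) + pi *+ 2 by rewrite -mulr_natl; ring.
by rewrite sinD2pi.
Qed.

(** With s the phase shift, the chain rule gives the derivative s'(t) times the integral of phi'(x +
    s(t)). The velocity at frequency w and phase x + s(t) is s'(t) plus the stationary velocity at
    frequency w - Omega and phase x. The latter contributes 0 by stationarity. *)
Lemma turned_kernel_solution (R : realType) (K alpha Omega psi : R)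
    (u g : R -> R) (nu : phase_kernel R) :
  let r := order_parameter (fun w => g (w + Omega)) nu 1 in
  is_density g -> continuous u -> on_circle nu ->
  r = `|r| * cis psi -> stationary K r psi nu ->
  kuramoto_solution K alpha u g
    (fun t => turned_kernel nu Omega (phase_shift Omega alpha u t)).
Proof.
move=> r gd cu nuc rE st.
pose s := phase_shift Omega alpha u.
have rtE t : order_parameter g (turned_kernel nu Omega (s t)) 1 = r * cis (s t).
  by rewrite order_parameter_turned_kernel// mul1r.
split; first by move=> t _; exact: on_circle_turned_kernel.
exists (fun t => psi + s t).
  by move=> t _; rewrite /= rtE normrM normr_cis mulr1 cisD mulrA -rE.
move=> w t phi t0 tphi.
have cphi := continuous_test_function tphi.
have [dphi cdphi pphi] := tphi.
have pdphi := periodic_derive1 tphi.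
rewrite rtE.
have -> :
    (fun t => \int[turned_kernel nu Omega (s t) w]_(x in circle R) phi x) =
    (fun y => \int[nu (w - Omega)]_x phi (x + y)) \o s.
  by apply/funext => t' /=; rewrite Rintegral_turned_kernel.
have nu1 : nu (w - Omega) setT = 1%E by exact: prob_kernel.
have dG := is_derive_Rintegral_shift (s t) nu1 tphi.
have ds := is_derive_phase_shift Omega alpha cu t0.
apply: (is_derive_eq (is_derive1_comp dG ds)).
rewrite Rintegral_turned_kernel//; last 2 first.
- by move=> x; apply: cvgM; [exact: cdphi|exact: continuous_velocity].
- by move=> x; rewrite pdphi periodic_velocity.
(* Stationarity is tested against the translate of [phi] by the current phase shift. *)
have [tphis dphis] := test_function_shift (s t) tphi.
have := st (w - Omega) _ tphis; rewrite dphis.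
set V := (velocity K 0 r psi (w - Omega)).
set D := fun x => derive1 phi (x + s t).
have cD : continuous D.
  move=> x; apply: continuous_comp; last exact: cdphi.
  by apply: cvgD; [exact: cvg_id|exact: cvg_cst].
have pD : periodic D (2 * pi) by move=> x; rewrite /D addrAC pdphi.
have cDV : continuous (fun x => D x * V x).
  by move=> x; apply: cvgM; [exact: cD|exact: continuous_velocity].
have pDV : periodic (fun x => D x * V x) (2 * pi).
  by move=> x; rewrite pD /V periodic_velocity.
rewrite (Rintegral_circle_periodic nuc _ cDV pDV) => DV0.
have bint (h : R -> R) : continuous h -> periodic h (2 * pi) ->
    (nu (w - Omega)).-integrable setT (EFin \o h).
  move=> ch ph; have [M hM] := periodic_bounded ch ph.
  apply: (@bounded_integrable _ _ _ (nu (w - Omega)) _ M) => //.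
  exact: continuous_measurable_fun.
(* The drift alpha u + w is split as (Omega + alpha u) + (w - Omega). *)
transitivity (\int[nu (w - Omega)]_x
    ((Omega + alpha * u t) * D x + D x * V x)).
  rewrite RintegralD; [|exact: measurableT| |].
  - rewrite DV0 addr0 RintegralZl; [exact: mulrC|exact: measurableT|].
    exact: bint.
  - have iD := bint _ cD pD.
    by have := @integrableZl _ _ _ _ _ measurableT (Omega + alpha * u t) _ iD.
  - exact: bint.
apply: eq_Rintegral => x _; rewrite /V /velocity -/(D x).
have -> : ComplexField.Normc.normc (r * cis (s t)) = ComplexField.Normc.normc r.
  apply: (@complexI R).
  by rewrite -[LHS]/(`|r * cis (s t)|) normrM normr_cis mulr1.
have -> : psi + s t - (x + s t) = psi - x by ring.
ring.
Qed.

(** * Sine moments of steady states *)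

(* The supremum S of all |e n| and |f n| satisfies |w| S <= a S. *)
Lemma contractive_recurrence (R : realType) (w a B : R) (e f : int -> R) :
  0 <= a -> a < `|w| -> e 0 = 0 -> f 0 = 0 ->
  (forall n, `|e n| <= B) -> (forall n, `|f n| <= B) ->
  (forall n, n != 0 -> w * f n = a / 2 * (e (n + 1) - e (n - 1))) ->
  (forall n, n != 0 -> w * e n = - (a / 2 * (f (n + 1) - f (n - 1)))) ->
  forall n, e n = 0.
Proof.
move=> a0 aw e0 f0 eB fB recf rece n.
pose A := [set y | exists n, y = `|e n| \/ y = `|f n|].
have supA : has_sup A.
  split; first by exists `|e 0|; exists 0; left.
  by exists B => _ [m [->|->]].
have eA m : `|e m| <= sup A by apply: ub_le_sup; [exact: supA.2|exists m; left].
have fA m : `|f m| <= sup A.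
  by apply: ub_le_sup; [exact: supA.2|exists m; right].
have S0 : 0 <= sup A by apply: le_trans (eA 0).
have w0 : 0 < `|w| by exact: le_lt_trans aw.
have bound x y z : w * x = a / 2 * (y - z) \/ w * x = - (a / 2 * (y - z)) ->
    `|y| <= sup A -> `|z| <= sup A -> `|x| <= a * sup A / `|w|.
  move=> E yA zA; rewrite ler_pdivlMr// mulrC.
  have -> : `|w| * `|x| = a / 2 * `|y - z|.
    rewrite -normrM; have a20 : 0 <= a / 2 by rewrite divr_ge0.
    by case: E => ->; rewrite ?normrN normrM (ger0_norm a20).
  have yz : `|y - z| <= sup A + sup A.
    by rewrite (le_trans (ler_normB _ _))// lerD.
  have -> : a * sup A = a / 2 * (sup A + sup A) by field.
  by rewrite ler_wpM2l// divr_ge0.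
(* At index 0 the recurrence is not assumed, but both entries are 0, so a nonnegative bound suffices
   there. *)
have q0 : 0 <= a * sup A / `|w| by rewrite divr_ge0// mulr_ge0.
have contr : sup A <= a * sup A / `|w|.
  apply: ge_sup; first exact: supA.1.
  move=> _ [m [->|->]]; have [->|m0] := eqVneq m 0; rewrite ?e0 ?f0 ?normr0//.
  - by apply: bound (fA _) (fA _); right; exact: rece.
  - by apply: bound (eA _) (eA _); left; exact: recf.
have : sup A <= 0.
  rewrite leNgt; apply/negP => Sgt0; move: contr.
  by rewrite leNgt ltr_pdivrMr// mulrC ltr_pM2l// aw.
by move=> S0'; apply/eqP; rewrite -normr_le0 (le_trans (eA n)).
Qed.

(** Nonnegativity is asked only almost everywhere because, for locked phases, the sign of the cosine
    is known only up to a null set. *)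
Lemma ae_eq0_of_Rintegral_eq0 d (T : measurableType d) (R : realType)
    (mu : {measure set T -> \bar R}) (F : T -> R) :
  mu.-integrable setT (EFin \o F) -> {ae mu, forall x, 0 <= F x} ->
  \int[mu]_x F x = 0 -> {ae mu, forall x, F x = 0}.
Proof.
move=> iF F0 intF0.
have mF : measurable_fun setT (EFin \o F) by exact: measurable_int iF.
have absF : (\int[mu]_x `|(EFin \o F) x| = 0)%E.
  transitivity (\int[mu]_x (EFin \o F) x)%E.
    apply: ae_eq_integral => //; first exact: measurableT_comp.
    by apply: filterS F0 => x Fx _ /=; rewrite ger0_norm.
  (* A real integral equal to 0 could also come from an infinite extended one, since [fine] sends
     infinities to 0; integrability excludes this. *)
  rewrite -[LHS]fineK ?integrable_fin_num//.
  by congr EFin.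
have := (ae_eq_integral_abs mu measurableT mF).1 absF.
by apply: filterS => x /(_ I) [].
Qed.

Lemma sin_eq0 (R : realType) (x : R) : sin x = 0 ->
  exists k : int, x = pi * k%:~R.
Proof.
move=> sx0; exists (Num.floor (x / pi)).
have pi0 := pi_gt0 R.
set k := Num.floor _.
have /andP[lo hi] := floor_itv (x / pi); rewrite -/k in lo hi.
pose y := x - pi * k%:~R.
(* The sine has period pi only up to sign, so its square is used to bring x into [0, pi), where the
   sine vanishes only at 0. *)
have psq : periodic (fun x : R => sin x ^+ 2) pi.
  by move=> z; rewrite sinDpi sqrrN.
have sy0 : sin y = 0.
  apply/eqP; rewrite -sqrf_eq0 /y -mulrN -mulrNz.
  by rewrite (periodic_int (f := fun x : R => sin x ^+ 2))// sx0 expr0n.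
have y0 : 0 <= y by rewrite subr_ge0 mulrC -ler_pdivlMr.
have ypi : y < pi.
  rewrite ltrBlDl -[X in _ + X]mulr1 -mulrDr mulrC -ltr_pdivrMr//.
  by rewrite intrD in hi.
apply/eqP; rewrite -subr_eq0 -/y eq_le y0 andbT leNgt; apply/negP => ygt0.
by have := @sin_gt0_pi R y; rewrite ygt0 ypi sy0 ltxx => /(_ isT).
Qed.

(** Induction with the addition formulas avoids writing x - y as a multiple of 2 pi. *)
Lemma sincos_natmul (R : realType) (x y : R) (n : nat) :
  sin x = sin y -> cos x = cos y ->
  sin (n%:R * x) = sin (n%:R * y) /\ cos (n%:R * x) = cos (n%:R * y).
Proof.
move=> sxy cxy; elim: n => [|n [IHs IHc]]; first by rewrite !mul0r.
by rewrite -addn1 natrD !mulrDl !mul1r !sinD !cosD IHs IHc sxy cxy.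
Qed.

Lemma sin_intmul (R : realType) (x y : R) (n : int) :
  sin x = sin y -> cos x = cos y -> sin (n%:~R * x) = sin (n%:~R * y).
Proof.
move=> sxy cxy; case: n => n; first by have [] := sincos_natmul n sxy cxy.
rewrite NegzE mulrNz !mulNr !sinN.
by have [-> _] := sincos_natmul n.+1 sxy cxy.
Qed.

Lemma is_derive_sin_mul (R : realType) (n x : R) :
  is_derive x 1 (fun x => sin (n * x)) (n * cos (n * x)).
Proof.
have -> : (fun x => sin (n * x)) = sin \o (fun x => n * x) by [].
by apply: is_derive_eq; rewrite /GRing.scale/= mulr1 mulrC.
Qed.

Lemma is_derive_cos_mul (R : realType) (n x : R) :
  is_derive x 1 (fun x => cos (n * x)) (- (n * sin (n * x))).
Proof.
have -> : (fun x => cos (n * x)) = cos \o (fun x => n * x) by [].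
by apply: is_derive_eq; rewrite /GRing.scale/= mulr1 mulrC mulrN.
Qed.

(** Three terms are what the product-to-sum formulas give in the moment recurrences. *)
Lemma Rintegral_comb3 d (T : measurableType d) (R : realType)
    (mu : {measure set T -> \bar R}) (c1 c2 c3 : R) (f1 f2 f3 : T -> R) :
  mu.-integrable setT (EFin \o f1) -> mu.-integrable setT (EFin \o f2) ->
  mu.-integrable setT (EFin \o f3) ->
  \int[mu]_x (c1 * f1 x + c2 * f2 x + c3 * f3 x) =
  c1 * \int[mu]_x f1 x + c2 * \int[mu]_x f2 x + c3 * \int[mu]_x f3 x.
Proof.
move=> i1 i2 i3.
have z c f : mu.-integrable setT (EFin \o f) ->
    mu.-integrable setT (EFin \o (fun x => c * f x)).
  by move=> i; have := @integrableZl _ _ _ _ _ measurableT c _ i.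
have i12 : mu.-integrable setT (EFin \o (fun x => c1 * f1 x + c2 * f2 x)).
  by have := integrableD measurableT (z c1 _ i1) (z c2 _ i2).
rewrite RintegralD//; last exact: z.
by rewrite RintegralD ?RintegralZl//; exact: z.
Qed.

(** * Stationary phase distribution at a single frequency *)

Section reduced.
Context (R : realType) (P : {measure set (measurableTypeR R) -> \bar R}).
Context (w a : R).
Hypothesis P1 : P setT = 1%E.
Hypothesis stat : forall phi, test_function phi ->
  \int[P]_x (derive1 phi x * (w - a * sin x)) = 0.

Let int_bounded (f : R -> R) (M : R) : continuous f ->
  (forall x, `|f x| <= M) -> P.-integrable setT (EFin \o f).
Proof.
move=> cf fM; apply: (@bounded_integrable _ _ _ P _ M) => //.
exact: continuous_measurable_fun.
Qed.

#[local] Instance ae_filter_P : Filter (nbhs (almost_everywhere P)).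
Proof. exact: ae_filter_ringOfSetsType. Qed.

Let int_cos (n : R) : P.-integrable setT (EFin \o (fun x : R => cos (n * x))).
Proof.
apply: (@int_bounded _ 1); first exact: continuous_cos_mul.
by move=> x; exact: cos_max.
Qed.

Let int_sin (n : R) : P.-integrable setT (EFin \o (fun x : R => sin (n * x))).
Proof.
apply: (@int_bounded _ 1); first exact: continuous_sin_mul.
by move=> x; exact: sin_max.
Qed.

(** Stationarity is tested against sin (n x), and cos (n x) sin x is expanded into sines of (n + 1)
    x and (n - 1) x. The common factor n is then cancelled, hence n != 0. *)
Lemma cos_moment_recurrence (n : int) : n != 0 ->
  w * \int[P]_x cos (n%:~R * x) =
  a / 2 * (\int[P]_x sin ((n + 1)%:~R * x) - \int[P]_x sin ((n - 1)%:~R * x)).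
Proof.
move=> n0; have nR0 : n%:~R != 0 :> R by rewrite intr_eq0.
have [tphi dphi] : test_function (fun x : R => sin (n%:~R * x)) /\
    derive1 (fun x : R => sin (n%:~R * x)) = (fun x => n%:~R * cos (n%:~R * x)).
  apply: test_function_derive => [x|x|].
  - exact: is_derive_sin_mul.
  - by apply: cvgM; [exact: cvg_cst|exact: continuous_cos_mul].
  - exact: sin_int_periodic.
have := stat tphi; rewrite dphi.
have E : (fun x => n%:~R * cos (n%:~R * x) * (w - a * sin x)) = (fun x =>
    n%:~R * w * cos (n%:~R * x) + - (n%:~R * a / 2) * sin ((n + 1)%:~R * x)
    + n%:~R * a / 2 * sin ((n - 1)%:~R * x)).
  apply/funext => x.
  rewrite !intrD mulrNz !mulrDl mulN1r mul1r !sinD sinN cosN; by field.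
rewrite E.
rewrite Rintegral_comb3; [|exact: int_cos|exact: int_sin|exact: int_sin].
move=> H; apply: (mulfI nR0); apply/eqP; rewrite -subr_eq0 -H; apply/eqP.
by field.
Qed.

(** Same computation with the test function cos (n x), whose derivative brings the minus sign. *)
Lemma sin_moment_recurrence (n : int) : n != 0 ->
  w * \int[P]_x sin (n%:~R * x) =
  - (a / 2 *
     (\int[P]_x cos ((n + 1)%:~R * x) - \int[P]_x cos ((n - 1)%:~R * x))).
Proof.
move=> n0; have nR0 : n%:~R != 0 :> R by rewrite intr_eq0.
have [tphi dphi] : test_function (fun x : R => cos (n%:~R * x)) /\
    derive1 (fun x : R => cos (n%:~R * x)) =
    (fun x => - (n%:~R * sin (n%:~R * x))).
  apply: test_function_derive => [x|x|].
  - exact: is_derive_cos_mul.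
  - apply: cvgN; apply: cvgM; [exact: cvg_cst|exact: continuous_sin_mul].
  - exact: cos_int_periodic.
have := stat tphi; rewrite dphi.
have E : (fun x => - (n%:~R * sin (n%:~R * x)) * (w - a * sin x)) = (fun x =>
    - (n%:~R * w) * sin (n%:~R * x) + - (n%:~R * a / 2) * cos ((n + 1)%:~R * x)
    + n%:~R * a / 2 * cos ((n - 1)%:~R * x)).
  apply/funext => x.
  rewrite !intrD mulrNz !mulrDl mulN1r mul1r !cosD sinN cosN; by field.
rewrite E.
rewrite Rintegral_comb3; [|exact: int_sin|exact: int_cos|exact: int_cos].
move=> H; apply: (mulfI nR0); apply/eqP; rewrite eq_sym -subr_eq0 -H; apply/eqP.
by field.
Qed.

Lemma locked_phase : `|w| < a -> P [set x | cos x < 0] = 0%E ->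
  {ae P, forall x, 0 <= cos x /\ w = a * sin x}.
Proof.
move=> wa Pneg.
have cvel : continuous (fun x : R => w - a * sin x).
  move=> x; apply: cvgB; first exact: cvg_cst.
  by apply: cvgM; [exact: cvg_cst|exact: continuous_sin].
have velM x : `|w - a * sin x| <= `|w| + `|a|.
  rewrite (le_trans (ler_normB _ _))// lerD2l normrM ler_piMr//.
  exact: sin_max.
have cos0 : {ae P, forall x, 0 <= cos x}.
  exists [set x | cos x < 0]; split => //.
  - rewrite -[X in measurable X]setTI.
    have mc : measurable_fun setT (@cos R).
      by apply: continuous_measurable_fun; exact: continuous_cos.
    have -> : [set x : R | cos x < 0] = @cos R @^-1` `]-oo, 0%R[%classic.
      by apply/seteqP; split => x /=; rewrite in_itv.
    by apply: mc => //; exact: measurable_itv.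
  - by move=> x /= /negP; rewrite -ltNge.
(* Tested against this function, the field gives cos x (w - a sin x)^2, which
   is nonnegative almost everywhere; its zeros other than sin x = w / a are at
   sin x = 1 and sin x = -1, where - sin x (w - a sin x) > 0, the field tested
   against cos, excludes them. *)
have [tphi dphi] :
    test_function (fun x : R => w * sin x - a / 2 * (sin x * sin x)) /\
    derive1 (fun x : R => w * sin x - a / 2 * (sin x * sin x)) =
    (fun x => cos x * (w - a * sin x)).
  apply: test_function_derive => [x|x|x].
  - by apply: is_derive_eq; rewrite /GRing.scale/=; field.
  - by apply: cvgM; [exact: continuous_cos|exact: cvel].
  - by rewrite mulr_natl sinD2pi.
have [tpsi dpsi] :
    test_function (@cos R) /\ derive1 (@cos R) = (fun x => - sin x).
  apply: test_function_derive => x.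
  - by apply: cvgN; exact: continuous_sin.
  - by rewrite mulr_natl cosD2pi.
have F0 : {ae P, forall x, cos x * (w - a * sin x) * (w - a * sin x) = 0}.
  apply: ae_eq0_of_Rintegral_eq0.
  - apply: (@int_bounded _ ((`|w| + `|a|) ^+ 2)).
      move=> x; apply: cvgM; last exact: cvel.
      by apply: cvgM; [exact: continuous_cos|exact: cvel].
    move=> x; rewrite -mulrA normrM -[leRHS]mul1r ler_pM ?cos_max//.
    by rewrite normrM expr2 ler_pM.
  - apply: filterS cos0 => x cx; rewrite -mulrA mulr_ge0//.
    by rewrite -expr2 sqr_ge0.
  - by rewrite -[RHS](stat tphi) dphi.
have G0 : {ae P, forall x, - sin x * (w - a * sin x) = 0}.
  apply: ae_eq0_of_Rintegral_eq0.
  - apply: (@int_bounded _ (1 * (`|w| + `|a|))).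
      move=> x; apply: cvgM; last exact: cvel.
      by apply: cvgN; exact: continuous_sin.
    by move=> x; rewrite normrM ler_pM ?normrN ?sin_max.
  - apply: filterS F0 => x /eqP.
    rewrite !mulf_eq0 -orbA orbb => /orP[/eqP cx|/eqP ->].
      have := cos2Dsin2 x; rewrite cx expr0n add0r => /eqP.
      move: wa; rewrite ltr_norml => /andP[wlo whi].
      by rewrite sqrf_eq1 => /orP[/eqP ->|/eqP ->]; lra.
    by rewrite mulr0.
  - by rewrite -[RHS](stat tpsi) dpsi.
apply: filterS3 cos0 F0 G0 => x cx Fx Gx; split=> //.
apply/eqP; rewrite -subr_eq0; apply/negPn/negP => v0.
have s0 : sin x = 0.
  by apply/eqP; move/eqP: Gx; rewrite mulf_eq0 (negbTE v0) orbF oppr_eq0.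
have c0 : cos x = 0.
  by apply/eqP; move/eqP: Fx; rewrite !mulf_eq0 (negbTE v0) !orbF.
have := cos2Dsin2 x; rewrite s0 c0 expr0n addr0 => /eqP.
by rewrite eq_sym oner_eq0.
Qed.

(** Almost every phase has the sine and cosine of y, so [P] integrates functions of the angle as a
    Dirac mass at y would. *)
Lemma locked_sin_moment (y : R) (n : int) :
  `|w| < a -> P [set x | cos x < 0] = 0%E ->
  0 <= cos y -> w = a * sin y ->
  \int[P]_x sin (n%:~R * x) = sin (n%:~R * y).
Proof.
move=> wa Pneg cy wy; have a0 : a != 0.
  by rewrite gt_eqF// (le_lt_trans _ wa).
transitivity (\int[P]_x cst (sin (n%:~R * y)) x); last first.
  by rewrite Rintegral_cst// P1 mulr1.
congr fine; apply: ae_eq_integral => //.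
  apply/measurable_EFinP; apply: continuous_measurable_fun.
  exact: continuous_sin_mul.
  by apply/measurable_EFinP; exact: measurable_cst.
apply: filterS (locked_phase wa Pneg) => x [cx wx] _ /=; congr EFin.
have sxy : sin x = sin y by apply: (mulfI a0); rewrite -wx.
(* The cosines have equal squares, and both are nonnegative. *)
apply: sin_intmul => //; apply/eqP.
by rewrite -(@eqrXn2 _ 2)// !cos2sin2 sxy.
Qed.

End reduced.

(** [P] and [Q] are the phase distributions at the opposite frequencies w and -w. If |w| < a, they
    are locked at opposite angles; if |w| > a, the recurrences force the moments of [Q] to be those
    of the reflection of [P]. *)
Lemma reflected_sin_moment (R : realType)
    (P Q : {measure set (measurableTypeR R) -> \bar R}) (w a : R) (n : int) :
  0 <= a -> P setT = 1%E -> Q setT = 1%E ->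
  (forall phi, test_function phi ->
    \int[P]_x (derive1 phi x * (w - a * sin x)) = 0) ->
  (forall phi, test_function phi ->
    \int[Q]_x (derive1 phi x * (- w - a * sin x)) = 0) ->
  (`|w| < a -> P [set x | cos x < 0] = 0%E) ->
  (`|w| < a -> Q [set x | cos x < 0] = 0%E) ->
  `|w| != a ->
  \int[Q]_x sin (n%:~R * x) = - \int[P]_x sin (n%:~R * x).
Proof.
move=> a0 P1 Q1 statP statQ negP negQ; rewrite neq_lt => /orP[wa|aw].
  have apos : 0 < a by rewrite (le_lt_trans _ wa).
  have b1 : -1 <= w / a <= 1.
    rewrite ler_pdivrMr// ler_pdivlMr// mulN1r mul1r.
    by move: wa; rewrite ltr_norml => /andP[/ltW -> /ltW ->].
  (* The arcsine lies in [-pi/2, pi/2], so it selects the locked phase with nonnegative cosine. *)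
  pose y := asin (w / a).
  have sy : w = a * sin y by rewrite /y asinK ?in_itv//= mulrC divfK// gt_eqF.
  have cy : 0 <= cos y.
    by rewrite cos_ge0_pihalf// asin_geNpi2// asin_lepi2.
  rewrite (locked_sin_moment P1 statP n wa (negP wa) cy sy).
  rewrite (@locked_sin_moment _ Q (- w) a Q1 statQ (- y) n) ?normrN//.
  - by rewrite mulrN sinN.
  - exact: negQ.
  - by rewrite cosN.
  - by rewrite sinN mulrN -sy.
apply/eqP; rewrite -addr_eq0 addrC; apply/eqP.
have sinM (m : int) (S : {measure set (measurableTypeR R) -> \bar R}) :
    S setT = 1%E -> `|\int[S]_x sin (m%:~R * x)| <= 1.
  move=> S1; apply: le_norm_Rintegral_bounded => // [|x]; last exact: sin_max.
  by apply: continuous_measurable_fun; exact: continuous_sin_mul.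
have cosM (m : int) (S : {measure set (measurableTypeR R) -> \bar R}) :
    S setT = 1%E -> `|\int[S]_x cos (m%:~R * x)| <= 1.
  move=> S1; apply: le_norm_Rintegral_bounded => // [|x]; last exact: cos_max.
  by apply: continuous_measurable_fun; exact: continuous_cos_mul.
have sin0M (S : {measure set (measurableTypeR R) -> \bar R}) :
    \int[S]_x sin (0%:~R * x) = 0.
  under eq_Rintegral do rewrite mul0r sin0.
  by rewrite Rintegral_cst// mul0r.
have cos0M (S : {measure set (measurableTypeR R) -> \bar R}) :
    S setT = 1%E -> \int[S]_x cos (0%:~R * x) = 1.
  move=> S1; under eq_Rintegral do rewrite mul0r cos0.
  by rewrite Rintegral_cst// S1 mul1r.
(* These combinations measure the failure of [Q] to be the reflection of [P]. The normalization of
   both measures cancels at m = 0, so the recurrences become homogeneous and contraction gives e =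
   0. *)
pose e m := \int[P]_x sin (m%:~R * x) + \int[Q]_x sin (m%:~R * x).
pose f m := \int[P]_x cos (m%:~R * x) - \int[Q]_x cos (m%:~R * x).
apply: (@contractive_recurrence _ w a 2 e f) => //.
- by rewrite /e !sin0M addr0.
- by rewrite /f !cos0M// subrr.
- by move=> m; rewrite (le_trans (ler_normD _ _))// lerD// sinM.
- by move=> m; rewrite (le_trans (ler_normB _ _))// lerD// cosM.
- move=> m m0; rewrite /e /f mulrBr (cos_moment_recurrence P1 statP m0).
  have -> y : w * y = - (- w * y) by rewrite mulNr opprK.
  by rewrite (cos_moment_recurrence Q1 statQ m0); ring.
- move=> m m0; rewrite /e /f mulrDr (sin_moment_recurrence P1 statP m0).
  have -> y : w * y = - (- w * y) by rewrite mulNr opprK.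
  by rewrite (sin_moment_recurrence Q1 statQ m0); ring.
Qed.

(** * Reality of the order parameters *)

(** Common form of the two alternatives in (i), with [a] standing for K |r|. When a = 0 the second
    clause is vacuous. *)
Definition reduced_steady_state (R : realType) (a : R) (nu : phase_kernel R) :
    Prop :=
  (forall w phi, test_function phi ->
    \int[nu w]_x (derive1 phi x * (w - a * sin x)) = 0) /\
  (forall w, `|w| < a -> nu w [set x | cos x < 0] = 0%E).

Lemma order_parameter_real (R : realType) (a : R) (g : R -> R)
    (nu : phase_kernel R) (n : int) :
  0 <= a -> is_density g -> (forall w, g (- w) = g w) -> on_circle nu ->
  reduced_steady_state a nu -> order_parameter g nu n \is Num.real.
Proof.
move=> a0 gd geven nuc [stat neg].
rewrite complex_real; apply/eqP.
have cS : continuous (fun x : R => sin (n%:~R * x)).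
  exact: continuous_sin_mul.
have pS := @sin_int_periodic R n.
(* The imaginary part integrates an odd function of w, except possibly at the two frequencies
   between the locked and drifting regimes. *)
apply: (@Rintegral_ae_odd _ [set a; - a]).
- apply: (@moment_integrable _ nu nuc g _ 1) => //.
    exact: continuous_measurable_fun.
  by move=> x; exact: sin_max.
- by apply: measurableU; exact: measurable_set1.
- by apply: countable_lebesgue_measure0; exact: finite_set_countable.
move=> w wN; rewrite geven -mulNr; congr (_ * _).
rewrite !(Rintegral_circle_periodic nuc _ cS pS).
have nw : `|w| != a.
  apply/eqP => wa; apply: wN; move: wa.
  by have [w0|w0] := ger0P w => <-; [left|right; rewrite opprK].
apply: (@reflected_sin_moment _ _ _ w a) => //.
- exact: prob_kernel.
- exact: prob_kernel.
- exact: stat.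
- exact: stat.
- exact: neg.
- by move=> wa; apply: neg; rewrite normrN.
Qed.

Lemma countable_sin_eq0 (R : realType) (psi : R) :
  countable [set x : R | sin (psi - x) = 0].
Proof.
apply: (@sub_countable _ _ _ [set: int]); last exact: countableP.
apply: card_le_trans (card_image_le (fun k : int => psi - pi * k%:~R) _).
apply: subset_card_le => x /= /sin_eq0[k kE].
by exists k => //; rewrite -kE; ring.
Qed.

(** At frequency 0 the velocity is K |r| sin (psi - x). Testing against cos (psi - x) gives K |r|
    times the integral of sin^2 (psi - x), which must be 0. If K |r| != 0, all the mass sits on the
    countable zero set of this sine, which is null for a density. *)
Lemma phase_density_incoherent (R : realType) (K psi : R) (r : R[i])
    (nu : phase_kernel R) :
  on_circle nu -> has_phase_density nu -> stationary K r psi nu ->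
  K * ComplexField.Normc.normc r = 0.
Proof.
move=> nuc [f fE] st; have [mf f0 nuE] := fE 0.
set a := K * _; apply/eqP/negPn/negP => a0.
have nu1 : nu 0 setT = 1%E by exact: prob_kernel.
pose s (x : R) := sin (psi - x).
have cs : continuous s.
  move=> x; apply: continuous_comp; last exact: continuous_sin.
  by apply: cvgB; [exact: cvg_cst|exact: cvg_id].
have ps : periodic s (2 * pi).
  move=> x; rewrite /s.
  have -> : psi - x = psi - (x + 2 * pi) + pi *+ 2 by rewrite -mulr_natl; ring.
  by rewrite sinD2pi.
have [tphi dphi] : test_function (fun x => cos (psi - x)) /\
    derive1 (fun x => cos (psi - x)) = s.
  apply: test_function_derive => [x|//|x].
  - have -> : (fun x => cos (psi - x)) = cos \o (fun x => psi - x) by [].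
    by apply: is_derive_eq; rewrite /GRing.scale/= /s; ring.
  - rewrite -[LHS]cosD2pi; congr (cos _).
    by rewrite -mulr_natl; ring.
have := st 0 _ tphi; rewrite dphi.
have -> : (fun x => s x * velocity K 0 r psi 0 x) = (fun x => a * (s x * s x)).
  by apply/funext => x; rewrite /velocity -/a -/(s x) !add0r; ring.
have css : continuous (fun x => a * (s x * s x)).
  by move=> x; apply: cvgM; [exact: cvg_cst|apply: cvgM; exact: cs].
have pss : periodic (fun x => a * (s x * s x)) (2 * pi).
  by move=> x; rewrite ps.
rewrite (Rintegral_circle_periodic nuc _ css pss) => int0.
have iss : (nu 0).-integrable setT (EFin \o (fun x => s x * s x)).
  apply: (@bounded_integrable _ _ _ (nu 0) _ 1) => //.
    by apply: continuous_measurable_fun => x; apply: cvgM; exact: cs.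
  by move=> x; rewrite normrM mulr_ile1// sin_max.
have ss0 : {ae nu 0, forall x, s x * s x = 0}.
  apply: ae_eq0_of_Rintegral_eq0 => //.
    by apply: aeW => x; rewrite -expr2 sqr_ge0.
  by apply: (mulfI a0); rewrite mulr0 -RintegralZl.
have [N [mN N0 subN]] := ss0.
pose Z := [set x : measurableTypeR R | s x = 0].
have mZ : measurable Z.
  rewrite -[X in measurable X]setTI.
  have ms := continuous_measurable_fun cs.
  have -> : Z = s @^-1` [set 0] by [].
  by apply: ms => //; exact: measurable_set1.
have Z0 : nu 0 Z = 0%E.
  rewrite nuE//; apply: null_set_integral => //.
    by apply/measurable_EFinP; exact: measurable_funTS.
  apply: countable_lebesgue_measure0; exact: countable_sin_eq0.
(* The zero set and the exceptional null set cover the line, so the total mass 1 would be at most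
   0. *)
have TZN : [set: measurableTypeR R] `<=` Z `|` N.
  move=> x _; have [sx|sx] := eqVneq (s x) 0; [by left|right].
  by apply: subN => /= /eqP; rewrite mulf_eq0 orbb; apply/negP.
have : (nu 0%R setT <= nu 0%R Z + nu 0%R N)%E.
  apply: (le_trans (le_measure _ _ _ TZN)); rewrite ?inE//.
    exact: measurableU.
  exact: measureU2.
by rewrite nu1 Z0 N0 adde0 lee_fin ler10.
Qed.

Lemma steady_state_reduced (R : realType) (K psi : R) (g : R -> R)
    (nu : phase_kernel R) :
  let r := order_parameter g nu 1 in
  0 < K -> on_circle nu -> r = `|r| * cis psi -> stationary K r psi nu ->
  has_phase_density nu \/ standard_form K g nu ->
  reduced_steady_state (K * ComplexField.Normc.normc r) nu.
Proof.
move=> r K0 nuc rE st H; set a := K * _.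
(* Either the coupling term vanishes and [psi] drops out of the velocity, or r = |r| != 0 forces
   e^{i psi} = 1. *)
have velE : a = 0 \/ sin psi = 0 /\ cos psi = 1.
  case: H => [dens|[rr _]]; first by left; exact: phase_density_incoherent st.
  have [->|r0] := eqVneq a 0; [by left|right].
  have nr0 : `|r| != 0.
    by apply: contra_neq r0 => /complexI nr0; rewrite /a nr0 mulr0.
  have : cis psi = 1 by apply: (mulfI nr0); rewrite mulr1 -rE.
  by case=> -> ->.
split.
  move=> w phi tphi; have := st w phi tphi.
  have -> : (fun x => derive1 phi x * velocity K 0 r psi w x) =
      (fun x => derive1 phi x * (w - a * sin x)).
    apply/funext => x; rewrite /velocity -/a add0r; congr (_ * (_ + _)).
    case: velE => [->|[s0 c1]]; first by rewrite !mul0r oppr0.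
    by rewrite sinB s0 c1 mul0r mul1r sub0r mulrN.
  rewrite Rintegral_circle_periodic//.
  - move=> x; apply: cvgM; first by case: tphi => _ cd _; exact: cd.
    apply: cvgB; first exact: cvg_cst.
    by apply: cvgM; [exact: cvg_cst|exact: continuous_sin].
  - move=> x; rewrite (periodic_derive1 tphi); congr (_ * (_ - _ * _)).
    by rewrite mulr_natl sinD2pi.
(* With a phase density a = 0, and no w satisfies |w| < 0. *)
case: H => [dens|[_ neg]] w; last exact: neg.
by rewrite /a (phase_density_incoherent nuc dens st) normr_lt0.
Qed.

Theorem theorem4p1 (R : realType) (K alpha Omega : R) (g u : R -> R)
    (K_gt0 : 0 < K) (g_density : is_density g) (g_mean : has_mean g Omega)
    (g_even_unimodal : even_unimodal g Omega)
    (u_bounded : bounded_fun u) (u_continuous : continuous u)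
    (rho_star : phase_kernel R) :
  let g0 := fun w => g (w + Omega) in
  let c := order_parameter g0 rho_star in
  steady_state K 0 u g0 rho_star ->
  (has_phase_density rho_star \/ standard_form K g0 rho_star ->
     forall n : int, c n \is Num.real) /\
  (exists rho : R -> phase_kernel R,
     [/\ kuramoto_solution K alpha u g rho,
         (forall t w (A : set R), 0 < t -> measurable A ->
            rho t w A =
            rho_star (w - Omega)
              ((fun x => mod2pi (x + phase_shift Omega alpha u t)) @^-1` A)) &
         forall (n : int) (t : R), 0 < t ->
           order_parameter g (rho t) n =
           c n * cis (n%:~R * phase_shift Omega alpha u t)]).
Proof.
move=> g0 c /steady_state_stationary[onc [psi rE st]].
split.
  move=> H n; have := steady_state_reduced K_gt0 onc rE st H.
  set a := K * _ => red.
  have a0 : 0 <= a by rewrite mulr_ge0 ?(ltW K_gt0)// normc_ge0.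
  apply: (order_parameter_real n a0 _ _ onc red).
    exact: density_shift.
  (* Centring turns the symmetry of [g] about [Omega] into evenness of [g0]. *)
  move=> w; have [geven _ _] := g_even_unimodal.
  by rewrite /g0 addrC -geven addrC.
exists (fun t => turned_kernel rho_star Omega (phase_shift Omega alpha u t)).
(* The pushforward description of [rho] holds by computation and is discharged here. *)
split => //.
- exact: turned_kernel_solution st.
- by move=> n t _; exact: order_parameter_turned_kernel.
Qed.
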